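(* There is no closed term in normal form (with respect to $\rightsquigarrow$) of type $\tau$; that is, there is no closed term $r$ with $r:\tau$ such that no $s$ satisfies $r\rightsquigarrow s$.
   Context: Types are generated by $A ::= \tau \mid A\Rightarrow A \mid A\wedge A$, where $\tau$ is the only atomic type ($\Rightarrow$ associates to the right). Type equivalence $\equiv$ is the smallest congruence on types such that $A\wedge B\equiv B\wedge A$, $A\wedge(B\wedge C)\equiv(A\wedge B)\wedge C$, $A\Rightarrow(B\wedge C)\equiv(A\Rightarrow B)\wedge(A\Rightarrow C)$ and $(A\wedge B)\Rightarrow C\equiv A\Rightarrow B\Rightarrow C$. To each type $A$ is associated an infinite set of variables $\mathcal V_A$, with $\mathcal V_A=\mathcal V_B$ if $A\equiv B$ and $\mathcal V_A\cap\mathcal V_B=\emptyset$ otherwise. Preterms are $r ::= x \mid \lambda x.r \mid rr \mid r\times r \mid \pi_A(r)$ (application left associative); one writes $\lambda x^A.r$ for $\lambda x.r$ when $x\in\mathcal V_A$. Introductions are abstractions and products; eliminations are applications and projections. Substitution $r[s/x]$ is as usual; a term is closed if it has no free variables. Typing $r:A$ (without contexts): $x:A$ if $x\in\mathcal V_A$; if $r:A$ and $A\equiv B$ then $r:B$; if $r:B$ then $\lambda x^A.r:A\Rightarrow B$; if $r:A\Rightarrow B$ and $s:A$ then $rs:B$; if $r:A$ and $s:B$ then $r\times s:A\wedge B$; if $r:A\wedge B$ then $\pi_A(r):A$. Terms are well-typed preterms. $\rightleftarrows$ is the smallest symmetric relation, closed under all term contexts, containing $r\times s\rightleftarrows s\times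 r$, $(r\times s)\times t\rightleftarrows r\times(s\times t)$, $\lambda x^A.(r\times s)\rightleftarrows \lambda x^A.r\times\lambda x^A.s$, $rst\rightleftarrows r(s\times t)$; $\rightleftarrows^*$ is its reflexive transitive closure. Reduction: $\to_{\beta\pi\zeta}$: if $s:A$ then $(\lambda x^A.r)s\to_{\beta\pi\zeta} r[s/x]$; if $r:A$ then $\pi_A(r\times s)\to_{\beta\pi\zeta} r$; $(r\times s)t\to_{\beta\pi\zeta} rt\times st$. $\to_{\eta\delta}$: if $r:A\Rightarrow B$, $r$ is an elimination or a variable, and $x\in\mathcal V_A$ fresh, then $r\to_{\eta\delta}\lambda x^A.(rx)$; if $r:A\wedge B$ and $r$ is an elimination or a variable, then $r\to_{\eta\delta}\pi_A(r)\times\pi_B(r)$. The relations $\hookrightarrow$ and $\to$ are the smallest relations such that: $r\to_{\beta\pi\zeta}s$ implies $r\hookrightarrow s$; $r\to_{\eta\delta}s$ implies $r\to s$; $r\hookrightarrow s$ implies $r\to s$; $r\to s$ implies $\lambda x.r\hookrightarrow\lambda x.s$; $r\hookrightarrow s$ implies $rt\hookrightarrow st$; $r\to s$ implies $tr\hookrightarrow ts$, $r\times t\hookrightarrow s\times t$, $t\times r\hookrightarrow t\times s$; $r\hookrightarrow s$ implies $\pi_A(r)\hookrightarrow\pi_A(s)$. Finally $r\rightsquigarrow s$ iff $r\rightleftarrows^* r'\to s'\rightleftarrows^* s$ for some $r',s'$. *)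

(* Defs.v *)
From Stdlib Require Import List Arith Lia Relations.
Import ListNotations.

Inductive type : Type :=
| Tau : type
| Arr : type -> type -> type
| Conj : type -> type -> type.

Declare Scope ty_scope.
Delimit Scope ty_scope with ty.
Bind Scope ty_scope with type.
Infix "⇒" := Arr (at level 55, right associativity) : ty_scope.
Infix "∧" := Conj (at level 50, left associativity) : ty_scope.
Open Scope ty_scope.

Reserved Notation "A ≡ B" (at level 70, no associativity).

Inductive ty_equiv : type -> type -> Prop :=
| te_comm A B : A ∧ B ≡ B ∧ A
| te_assoc A B C : A ∧ (B ∧ C) ≡ (A ∧ B) ∧ C
| te_dist A B C : A ⇒ (B ∧ C) ≡ (A ⇒ B) ∧ (A ⇒ C)
| te_curry A B C : (A ∧ B) ⇒ C ≡ A ⇒ B ⇒ C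
| te_refl A : A ≡ A
| te_sym A B : A ≡ B -> B ≡ A
| te_trans A B C : A ≡ B -> B ≡ C -> A ≡ C
| te_arr A A' B B' : A ≡ A' -> B ≡ B' -> A ⇒ B ≡ A' ⇒ B'
| te_conj A A' B B' : A ≡ A' -> B ≡ B' -> A ∧ B ≡ A' ∧ B'
where "A ≡ B" := (ty_equiv A B).

(* A variable is a name tagged with a type; tagging with equivalent types gives
   distinct variables of one and the same set [V A].  The lemmas below show
   that the sets [V A] are as required. *)
Definition var : Type := (nat * type)%type.

Definition V (A : type) (x : var) : Prop := snd x ≡ A.

Definition type_eq_dec (A B : type) : {A = B} + {A <> B}.
Proof. decide equality. Defined.

Definition var_eq_dec (x y : var) : {x = y} + {x <> y}.
Proof. decide equality; [apply type_eq_dec | apply Nat.eq_dec]. Defined.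

Definition fresh (x : var) (l : list var) : var :=
  (S (list_max (map fst l)), snd x).

Lemma fresh_notin (x : var) (l : list var) : ~ In (fresh x l) l.
Proof.
  intros H. apply (in_map fst) in H. simpl in H.
  pose proof (proj1 (list_max_le (map fst l) _) (le_n _)) as Hm.
  rewrite Forall_forall in Hm. specialize (Hm _ H). lia.
Qed.

Lemma V_infinite (A : type) (l : list var) : exists x, V A x /\ ~ In x l.
Proof.
  exists (fresh (0, A) l). split; [apply te_refl | apply fresh_notin].
Qed.

Lemma V_equiv (A B : type) : A ≡ B -> forall x, V A x <-> V B x.
Proof.
  intros H x; split; intros Hx; eapply te_trans; eauto using te_sym.
Qed.

Lemma V_disjoint (A B : type) : ~ A ≡ B -> forall x, ~ (V A x /\ V B x).
Proof.
  intros H x [HA HB]. apply H. eapply te_trans; [apply te_sym, HA | exact HB].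
Qed.

Lemma V_cover (x : var) : exists A, V A x.
Proof. exists (snd x). apply te_refl. Qed.

Inductive preterm : Type :=
| Var : var -> preterm
| Lam : var -> preterm -> preterm
| App : preterm -> preterm -> preterm
| Prod : preterm -> preterm -> preterm
| Proj : type -> preterm -> preterm.

Fixpoint fv (r : preterm) : list var :=
  match r with
  | Var x => [x]
  | Lam x r => remove var_eq_dec x (fv r)
  | App r s => fv r ++ fv s
  | Prod r s => fv r ++ fv s
  | Proj _ r => fv r
  end.

Definition closed (r : preterm) : Prop := forall x, ~ In x (fv r).

Definition elim_or_var (r : preterm) : Prop :=
  match r with
  | Var _ | App _ _ | Proj _ _ => True
  | Lam _ _ | Prod _ _ => False
  end.

Definition upd (f : var -> preterm) (x : var) (s : preterm) : var -> preterm :=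
  fun y => if var_eq_dec x y then s else f y.

(* Simultaneous capture-avoiding substitution: a binder is renamed, within its
   own set of variables, exactly when it would capture a free variable of one
   of the substituted terms. *)
Fixpoint msubst (f : var -> preterm) (r : preterm) : preterm :=
  match r with
  | Var x => f x
  | Lam x r =>
      let avoid := flat_map (fun z => fv (f z)) (remove var_eq_dec x (fv r)) in
      let y := if in_dec var_eq_dec x avoid then fresh x avoid else x in
      Lam y (msubst (upd f x (Var y)) r)
  | App r s => App (msubst f r) (msubst f s)
  | Prod r s => Prod (msubst f r) (msubst f s)
  | Proj A r => Proj A (msubst f r)
  end.

(* [subst r s x] is r[s/x]. *)
Definition subst (r s : preterm) (x : var) : preterm := msubst (upd Var x s) r.

Inductive alpha : preterm -> preterm -> Prop :=
| al_rename A x y r : V A x -> V A y -> ~ In y (fv (Lam x r)) ->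
    alpha (Lam x r) (Lam y (subst r (Var y) x))
| al_refl r : alpha r r
| al_sym r s : alpha r s -> alpha s r
| al_trans r s t : alpha r s -> alpha s t -> alpha r t
| al_lam x r s : alpha r s -> alpha (Lam x r) (Lam x s)
| al_app r r' s s' : alpha r r' -> alpha s s' -> alpha (App r s) (App r' s')
| al_prod r r' s s' : alpha r r' -> alpha s s' -> alpha (Prod r s) (Prod r' s')
| al_proj A r s : alpha r s -> alpha (Proj A r) (Proj A s).

Inductive has_type : preterm -> type -> Prop :=
| ty_var A x : V A x -> has_type (Var x) A
| ty_eq A B r : has_type r A -> A ≡ B -> has_type r B
| ty_lam A B x r : V A x -> has_type r B -> has_type (Lam x r) (A ⇒ B)
| ty_app A B r s : has_type r (A ⇒ B) -> has_type s A -> has_type (App r s) B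
| ty_prod A B r s : has_type r A -> has_type s B -> has_type (Prod r s) (A ∧ B)
| ty_proj A B r : has_type r (A ∧ B) -> has_type (Proj A r) A.

Inductive iso : preterm -> preterm -> Prop :=
| iso_comm r s : iso (Prod r s) (Prod s r)
| iso_assoc r s t : iso (Prod (Prod r s) t) (Prod r (Prod s t))
| iso_dist x r s : iso (Lam x (Prod r s)) (Prod (Lam x r) (Lam x s))
| iso_curry r s t : iso (App (App r s) t) (App r (Prod s t))
| iso_sym r s : iso r s -> iso s r
| iso_lam x r s : iso r s -> iso (Lam x r) (Lam x s)
| iso_appl r s t : iso r s -> iso (App r t) (App s t)
| iso_appr r s t : iso r s -> iso (App t r) (App t s)
| iso_prodl r s t : iso r s -> iso (Prod r t) (Prod s t)
| iso_prodr r s t : iso r s -> iso (Prod t r) (Prod t s)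
| iso_proj A r s : iso r s -> iso (Proj A r) (Proj A s).

(* Terms are considered up to alpha-equivalence: alpha steps may be interleaved
   with [iso] steps. *)
Definition isos : preterm -> preterm -> Prop :=
  clos_refl_trans preterm (fun r s => alpha r s \/ iso r s).

Inductive red_bpz : preterm -> preterm -> Prop :=
| r_beta A x r s : V A x -> has_type s A -> red_bpz (App (Lam x r) s) (subst r s x)
| r_pi A r s : has_type r A -> red_bpz (Proj A (Prod r s)) r
| r_zeta r s t : red_bpz (App (Prod r s) t) (Prod (App r t) (App s t)).

Inductive red_ed : preterm -> preterm -> Prop :=
| r_eta A B x r : has_type r (A ⇒ B) -> elim_or_var r -> V A x -> ~ In x (fv r) ->
    red_ed r (Lam x (App r (Var x)))
| r_delta A B r : has_type r (A ∧ B) -> elim_or_var r ->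
    red_ed r (Prod (Proj A r) (Proj B r)).

(* [hook] is ↪ and [step] is →. *)
Inductive hook : preterm -> preterm -> Prop :=
| h_bpz r s : red_bpz r s -> hook r s
| h_lam x r s : step r s -> hook (Lam x r) (Lam x s)
| h_appl r s t : hook r s -> hook (App r t) (App s t)
| h_appr r s t : step r s -> hook (App t r) (App t s)
| h_prodl r s t : step r s -> hook (Prod r t) (Prod s t)
| h_prodr r s t : step r s -> hook (Prod t r) (Prod t s)
| h_proj A r s : hook r s -> hook (Proj A r) (Proj A s)
with step : preterm -> preterm -> Prop :=
| s_ed r s : red_ed r s -> step r s
| s_hook r s : hook r s -> step r s.

Definition red (r s : preterm) : Prop :=
  exists r' s', isos r r' /\ step r' s' /\ isos s' s.

Infix "⇝" := red (at level 70, no associativity).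

Definition normal (r : preterm) : Prop := ~ exists s, r ⇝ s.

(* Main.v *)
From Stdlib Require Import List Relations Permutation SetoidList SetoidPermutation.
Require Import Defs.
Import ListNotations.

(** Up to [≡], every type is a conjunction of prime types
    [P1 ⇒ ... ⇒ Pn ⇒ Tau], and the multiset of these primes, as well as the
    multiset of arguments of each of them, is an invariant of [≡].  A term that
    does not reduce is, up to [isos], a product of terms of prime types: a
    non-prime elimination or variable would be delta-expanded, and products
    float out of abstractions.  A closed term of type [Tau] is an elimination
    whose head is an introduction.  If the head is (up to [isos]) a product, then
    zeta or pi applies.  Otherwise it is an abstraction of prime type, so no
    projection occurs above it and it is applied to enough arguments to reach
    [Tau]; these can be regrouped by prime types so that the first group has
    the type of the bound variable, and beta applies. *)

Local Hint Constructors ty_equiv : core.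

#[local] Instance ty_equiv_equivalence : Equivalence ty_equiv.
Proof. split; red; eauto. Qed.

Notation args_equiv := (PermutationA ty_equiv).
Notation factors_equiv := (PermutationA (PermutationA ty_equiv)).

(** * Prime factorisation of types *)

Definition arrows (l : list type) : type := fold_right Arr Tau l.

(* A prime type is represented by the list of its arguments. *)
Fixpoint factors (A : type) : list (list type) :=
  match A with
  | Tau => [[]]
  | Arr A B => map (app (map arrows (factors A))) (factors B)
  | Conj A B => factors A ++ factors B
  end.

(* [Tau] is a junk value for the empty list, as is [Var (0, Tau)] in [bigprod]. *)
Fixpoint bigconj (l : list type) : type :=
  match l with
  | [] => Tau
  | [A] => A
  | A :: l => Conj A (bigconj l)
  end.

(** Two maps are needed because, in the congruence rule for arrows, the prepended list of arguments
    changes together with the factors. *)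
Lemma PermutationA_map {X Y : Type} (R : relation X) (S : relation Y) (f g : X -> Y) :
  (forall x y, R x y -> S (f x) (g y)) -> Equivalence R -> Equivalence S ->
  forall l l', PermutationA R l l' -> PermutationA S (map f l) (map g l').
Proof.
  intros H HR HS.
  (* Exchanging [f] for [g] on a fixed list serves the swap case and, read backwards, the middle
     list of the transitivity case. *)
  assert (Hr : forall l, PermutationA S (map f l) (map g l)).
  { induction l; simpl; constructor; [apply H; reflexivity | assumption]. }
  induction 1; simpl.
  - constructor.
  - constructor; auto.
  - eapply permA_trans; [apply permA_swap|]. apply (Hr (x :: y :: l)).
  - eapply permA_trans; [eassumption|].
    eapply permA_trans; [symmetry; apply Hr | eassumption].
Qed.

Lemma PermutationA_length {X : Type} (R : relation X) (l l' : list X) :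
  PermutationA R l l' -> length l = length l'.
Proof. induction 1; simpl; congruence. Qed.

Lemma PermutationA_singleton {X : Type} (R : relation X) (HR : Equivalence R)
  (l : list X) (y : X) :
  PermutationA R l [y] -> exists x, l = [x] /\ R x y.
Proof.
  intros H. pose proof (PermutationA_length _ _ _ H) as Hl.
  destruct l as [|x [|z l]]; try discriminate Hl.
  exists x; split; [reflexivity|].
  assert (HI : InA R x [y]).
  { apply (PermutationA_equivlistA HR H). constructor. reflexivity. }
  inversion HI; subst; [assumption | inversion H1].
Qed.

Lemma arrows_equiv (l l' : list type) : args_equiv l l' -> arrows l ≡ arrows l'.
Proof.
  induction 1; simpl; eauto.
Qed.

(** Associativity, distributivity and currying leave [factors] literally unchanged; commutativity
    permutes it. Equivalent domains permute the arguments inside each factor, and those arguments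
    agree only up to [≡], hence the nested relation. *)
Lemma factors_invariant (A B : type) : A ≡ B -> factors_equiv (factors A) (factors B).
Proof.
  induction 1; simpl.
  - apply PermutationA_app_comm. typeclasses eauto.
  - rewrite app_assoc. reflexivity.
  - rewrite map_app. reflexivity.
  - rewrite map_map, map_app.
    erewrite map_ext; [reflexivity|]. intros; simpl; now rewrite app_assoc.
  - reflexivity.
  - now symmetry.
  - etransitivity; eassumption.
  - assert (HA : args_equiv (map arrows (factors A)) (map arrows (factors A'))).
    { eapply PermutationA_map; try eassumption; try typeclasses eauto; auto using arrows_equiv. }
    eapply PermutationA_map; try eassumption; try typeclasses eauto.
    intros x y Hxy. apply PermutationA_app; [typeclasses eauto | assumption..].
  - apply PermutationA_app; [typeclasses eauto | assumption..].
Qed.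

Lemma factors_nonempty (A : type) : factors A <> [].
Proof.
  induction A; simpl; intros H.
  - discriminate.
  - apply IHA2. eapply map_eq_nil; eassumption.
  - apply app_eq_nil in H. tauto.
Qed.

Lemma bigconj_app (l l' : list type) :
  l <> [] -> l' <> [] -> bigconj (l ++ l') ≡ bigconj l ∧ bigconj l'.
Proof.
  intros Hl Hl'. induction l as [|A [|B l] IH]; [easy| |].
  - simpl. destruct l'; easy.
  - change (A ∧ bigconj ((B :: l) ++ l') ≡ (A ∧ bigconj (B :: l)) ∧ bigconj l').
    assert (H : B :: l <> []) by easy. specialize (IH H). eauto.
Qed.

Lemma arr_bigconj (A : type) (l : list type) :
  l <> [] -> A ⇒ bigconj l ≡ bigconj (map (Arr A) l).
Proof.
  intros Hl. induction l as [|B [|C l] IH]; [easy | simpl; auto|].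
  assert (H : C :: l <> []) by easy. specialize (IH H).
  change (A ⇒ (B ∧ bigconj (C :: l)) ≡ (A ⇒ B) ∧ bigconj (map (Arr A) (C :: l))).
  eauto.
Qed.

Lemma bigconj_arr (l : list type) (B : type) :
  l <> [] -> bigconj l ⇒ B ≡ fold_right Arr B l.
Proof.
  intros Hl. induction l as [|A [|C l] IH]; [easy | simpl; auto|].
  assert (H : C :: l <> []) by easy. specialize (IH H).
  change ((A ∧ bigconj (C :: l)) ⇒ B ≡ A ⇒ fold_right Arr B (C :: l)).
  eauto.
Qed.

Lemma bigconj_ext {X : Type} (f g : X -> type) (l : list X) :
  (forall x, f x ≡ g x) -> bigconj (map f l) ≡ bigconj (map g l).
Proof.
  intros H. induction l as [|x [|y l] IH]; simpl; auto.
Qed.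

Lemma map_nonempty {X Y : Type} (f : X -> Y) (l : list X) : l <> [] -> map f l <> [].
Proof. now destruct l. Qed.

(** The factorisation of [A] is a hypothesis so that this can serve inside the induction that proves
    it. *)
Lemma arr_arrows (A : type) (P : list type) :
  A ≡ bigconj (map arrows (factors A)) ->
  A ⇒ arrows P ≡ arrows (map arrows (factors A) ++ P).
Proof.
  intros H. unfold arrows at 2. rewrite fold_right_app.
  eapply te_trans; [|apply bigconj_arr, map_nonempty, factors_nonempty]. auto.
Qed.

(** For an arrow, distributivity moves the conjunction of the codomain outwards and currying turns
    the conjunction of the domain into successive arguments. *)
Lemma factorisation (A : type) : A ≡ bigconj (map arrows (factors A)).
Proof.
  induction A; simpl; auto.
  - eapply te_trans; [apply te_arr; [apply te_refl | exact IHA2]|].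
    eapply te_trans; [apply arr_bigconj, map_nonempty, factors_nonempty|].
    rewrite !map_map. apply bigconj_ext. intros P. now apply arr_arrows.
  - rewrite map_app. apply te_sym.
    eapply te_trans; [apply bigconj_app; apply map_nonempty, factors_nonempty|]. auto.
Qed.

(** * Products modulo isomorphism *)

Lemma isos_refl (r : preterm) : isos r r.
Proof. apply rt_refl. Qed.

Lemma isos_trans (r s t : preterm) : isos r s -> isos s t -> isos r t.
Proof. intros; eapply rt_trans; eassumption. Qed.

Lemma iso_isos (r s : preterm) : iso r s -> isos r s.
Proof. intros; apply rt_step; auto. Qed.

Lemma isos_context (f : preterm -> preterm) :
  (forall r s, alpha r s -> alpha (f r) (f s)) ->
  (forall r s, iso r s -> iso (f r) (f s)) ->
  forall r s, isos r s -> isos (f r) (f s).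
Proof.
  intros Ha Hi r s. induction 1 as [r s [H|H]| |].
  - apply rt_step; auto.
  - apply rt_step; auto.
  - apply rt_refl.
  - eapply rt_trans; eassumption.
Qed.

Lemma isos_lam x r s : isos r s -> isos (Lam x r) (Lam x s).
Proof. apply (isos_context (Lam x)); auto using al_lam, iso_lam. Qed.

Lemma isos_appl r s t : isos r s -> isos (App r t) (App s t).
Proof. apply (isos_context (fun r => App r t)); auto using al_app, al_refl, iso_appl. Qed.

Lemma isos_appr r s t : isos r s -> isos (App t r) (App t s).
Proof. apply (isos_context (App t)); auto using al_app, al_refl, iso_appr. Qed.

Lemma isos_prodl r s t : isos r s -> isos (Prod r t) (Prod s t).
Proof. apply (isos_context (fun r => Prod r t)); auto using al_prod, al_refl, iso_prodl. Qed.

Lemma isos_prodr r s t : isos r s -> isos (Prod t r) (Prod t s).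
Proof. apply (isos_context (Prod t)); auto using al_prod, al_refl, iso_prodr. Qed.

Lemma isos_proj A r s : isos r s -> isos (Proj A r) (Proj A s).
Proof. apply (isos_context (Proj A)); auto using al_proj, iso_proj. Qed.

Lemma isos_prod r r' s s' : isos r r' -> isos s s' -> isos (Prod r s) (Prod r' s').
Proof.
  intros H H'. eapply isos_trans; [apply isos_prodl, H | apply isos_prodr, H'].
Qed.

Fixpoint bigprod (l : list preterm) : preterm :=
  match l with
  | [] => Var (0, Tau)
  | [r] => r
  | r :: l => Prod r (bigprod l)
  end.

Lemma bigprod_cons r l : l <> [] -> bigprod (r :: l) = Prod r (bigprod l).
Proof. now destruct l. Qed.

Lemma bigprod_app (l l' : list preterm) :
  l <> [] -> l' <> [] -> isos (Prod (bigprod l) (bigprod l')) (bigprod (l ++ l')).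
Proof.
  intros Hl Hl'. induction l as [|r [|s l] IH]; [easy| |].
  - simpl. destruct l'; [easy | apply isos_refl].
  - change ((r :: s :: l) ++ l') with (r :: ((s :: l) ++ l')).
    rewrite !bigprod_cons by easy.
    eapply isos_trans; [apply iso_isos, iso_assoc|].
    apply isos_prodr, IH. easy.
Qed.

(** The same induction run backwards, which avoids establishing symmetry of [isos]. *)
Lemma bigprod_app_sym (l l' : list preterm) :
  l <> [] -> l' <> [] -> isos (bigprod (l ++ l')) (Prod (bigprod l) (bigprod l')).
Proof.
  intros Hl Hl'. induction l as [|r [|s l] IH]; [easy| |].
  - simpl. destruct l'; [easy | apply isos_refl].
  - change ((r :: s :: l) ++ l') with (r :: ((s :: l) ++ l')).
    rewrite !bigprod_cons by easy.
    eapply isos_trans; [|apply iso_isos, iso_sym, iso_assoc].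
    apply isos_prodr, IH. easy.
Qed.

Lemma bigprod_permutation (l l' : list preterm) :
  Permutation l l' -> isos (bigprod l) (bigprod l').
Proof.
  induction 1.
  - apply isos_refl.
  - destruct l as [|y l].
    + apply Permutation_nil in H. subst. apply isos_refl.
    + destruct l' as [|z l'].
      * now apply Permutation_sym, Permutation_nil in H.
      * now apply isos_prodr.
  - destruct l as [|z l]; [apply iso_isos, iso_comm|].
    rewrite !bigprod_cons by easy.
    eapply isos_trans; [apply iso_isos, iso_sym, iso_assoc|].
    eapply isos_trans; [apply isos_prodl, iso_isos, iso_comm|].
    apply iso_isos, iso_assoc.
  - eapply isos_trans; eassumption.
Qed.

Lemma lam_bigprod x (l : list preterm) :
  l <> [] -> isos (Lam x (bigprod l)) (bigprod (map (Lam x) l)).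
Proof.
  intros Hl. induction l as [|r [|s l] IH]; [easy | apply isos_refl |].
  change (map (Lam x) (r :: s :: l)) with (Lam x r :: map (Lam x) (s :: l)).
  rewrite !bigprod_cons by easy.
  eapply isos_trans; [apply iso_isos, iso_dist|].
  apply isos_prodr, IH. easy.
Qed.

Lemma has_type_bigprod (l : list preterm) (Ts : list type) :
  Forall2 has_type l Ts -> l <> [] -> has_type (bigprod l) (bigconj Ts).
Proof.
  induction 1 as [|r A l Ts Hr Hl IH]; [easy|]. intros _.
  destruct Hl; [assumption|].
  apply ty_prod; [assumption | now apply IH].
Qed.

(** Terms move along with their types, and [ty_eq] absorbs the pointwise equivalences. *)
Lemma Forall2_has_type_permute (Ts Ts' : list type) :
  args_equiv Ts Ts' -> forall l, Forall2 has_type l Ts ->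
  exists l', Permutation l l' /\ Forall2 has_type l' Ts'.
Proof.
  induction 1; intros ts Hts.
  - exists ts; auto.
  - inversion Hts; subst. destruct (IHPermutationA _ H5) as (l' & Hp & Hl').
    eexists (_ :: l'). split; [apply perm_skip; eassumption|].
    constructor; [|assumption]. eapply ty_eq; eassumption.
  - inversion Hts as [|a ? ? ? ? Hts']; subst. inversion Hts'; subst.
    eexists. split; [apply perm_swap|]. auto.
  - destruct (IHPermutationA1 _ Hts) as (l' & Hp & Hl').
    destruct (IHPermutationA2 _ Hl') as (l'' & Hp' & Hl'').
    exists l''. split; [eapply perm_trans; eassumption | assumption].
Qed.

Lemma Forall2_nonempty {X Y : Type} (R : X -> Y -> Prop) (l : list X) (l' : list Y) :
  Forall2 R l l' -> l' <> [] -> l <> [].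
Proof. intros []; easy. Qed.

(** * Reducibility modulo isomorphism *)

(** Two notions are kept because the function side of an application and the body of a projection
    admit only [hook]; every other context takes any [step] and yields a [hook]. *)
Definition step_mod (r : preterm) : Prop := exists r' s, isos r r' /\ step r' s.

Definition hook_mod (r : preterm) : Prop := exists r' s, isos r r' /\ hook r' s.

Lemma hook_step_mod r : hook_mod r -> step_mod r.
Proof. intros (r' & s & H & Hs). exists r', s. split; [assumption | now apply s_hook]. Qed.

Lemma hook_mod_isos r s : isos r s -> hook_mod s -> hook_mod r.
Proof.
  intros H (s' & t & Hs & Ht). exists s', t. split; [|assumption].
  eapply isos_trans; eassumption.
Qed.

Lemma hook_mod_lam x r : step_mod r -> hook_mod (Lam x r).
Proof.
  intros (r' & s & H & Hs). exists (Lam x r'), (Lam x s).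
  split; [now apply isos_lam | now apply h_lam].
Qed.

Lemma hook_mod_appl r t : hook_mod r -> hook_mod (App r t).
Proof.
  intros (r' & s & H & Hs). exists (App r' t), (App s t).
  split; [now apply isos_appl | now apply h_appl].
Qed.

Lemma hook_mod_appr r t : step_mod r -> hook_mod (App t r).
Proof.
  intros (r' & s & H & Hs). exists (App t r'), (App t s).
  split; [now apply isos_appr | now apply h_appr].
Qed.

Lemma hook_mod_prodl r t : step_mod r -> hook_mod (Prod r t).
Proof.
  intros (r' & s & H & Hs). exists (Prod r' t), (Prod s t).
  split; [now apply isos_prodl | now apply h_prodl].
Qed.

Lemma hook_mod_prodr r t : step_mod r -> hook_mod (Prod t r).
Proof.
  intros (r' & s & H & Hs). exists (Prod t r'), (Prod t s).
  split; [now apply isos_prodr | now apply h_prodr].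
Qed.

Lemma hook_mod_proj A r : hook_mod r -> hook_mod (Proj A r).
Proof.
  intros (r' & s & H & Hs). exists (Proj A r'), (Proj A s).
  split; [now apply isos_proj | now apply h_proj].
Qed.

Lemma hook_mod_bpz r s : red_bpz r s -> hook_mod r.
Proof. intros H. exists r, s. split; [apply isos_refl | now apply h_bpz]. Qed.

(** * Splitting irreducible terms into prime components *)

(** The components follow the order of [factors A], so those of a conjunction can be cut into two
    consecutive blocks. *)
Definition splits (r : preterm) (A : type) : Prop :=
  exists l, isos r (bigprod l) /\ Forall2 has_type l (map arrows (factors A)).

Lemma map_arrows_factors_nonempty A : map arrows (factors A) <> [].
Proof. apply map_nonempty, factors_nonempty. Qed.

Lemma splits_equiv r A B : A ≡ B -> splits r A -> splits r B.
Proof.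
  intros HAB (l & Hl & HT).
  assert (H : args_equiv (map arrows (factors A)) (map arrows (factors B))).
  { eapply PermutationA_map; try typeclasses eauto;
      [apply arrows_equiv | now apply factors_invariant]. }
  destruct (Forall2_has_type_permute _ _ H _ HT) as (l' & Hp & Hl').
  exists l'. split; [|assumption].
  eapply isos_trans; [exact Hl | now apply bigprod_permutation].
Qed.

Lemma splits_lam x r A B : V A x -> splits r B -> splits (Lam x r) (A ⇒ B).
Proof.
  intros Hx (l & Hl & HT).
  pose proof (Forall2_nonempty _ _ _ HT (map_arrows_factors_nonempty B)) as Hne.
  exists (map (Lam x) l). split.
  - eapply isos_trans; [apply isos_lam, Hl | now apply lam_bigprod].
  - simpl. rewrite map_map. clear Hl Hne. revert l HT.
    induction (factors B) as [|P Ps IH]; intros l HT; inversion HT; subst; simpl;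
      constructor; auto.
    eapply ty_eq; [apply ty_lam; eassumption | apply arr_arrows, factorisation].
Qed.

Lemma splits_prod r s A B : splits r A -> splits s B -> splits (Prod r s) (A ∧ B).
Proof.
  intros (l & Hl & HT) (l' & Hl' & HT').
  exists (l ++ l'). split.
  - eapply isos_trans; [apply isos_prod; eassumption|].
    apply bigprod_app; eapply Forall2_nonempty; eauto using map_arrows_factors_nonempty.
  - simpl. rewrite map_app. now apply Forall2_app.
Qed.

Lemma splits_elim r A : has_type r A -> elim_or_var r -> step_mod r \/ splits r A.
Proof.
  intros Hr He. pose proof (factorisation A) as HA.
  destruct (factors A) as [|P [|Q l]] eqn:E.
  - now apply factors_nonempty in E.
  - right. exists [r]. rewrite E. split; [apply isos_refl|].
    constructor; [eapply ty_eq; eassumption | constructor].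
  - left. eexists r, _. split; [apply isos_refl|].
    (* With at least two factors, [HA] presents [A] as the conjunction of its first prime with the
       rest. *)
    apply s_ed. eapply r_delta; [|assumption]. eapply ty_eq; [exact Hr | exact HA].
Qed.

(** The middle case is a delta expansion at the root, which is not a [hook]. Recording [elim_or_var]
    there lets an introduction rule it out. *)
Lemma step_or_splits r A :
  has_type r A -> hook_mod r \/ (elim_or_var r /\ step_mod r) \/ splits r A.
Proof.
  induction 1 as [A x Hx | A B r Hr IH HAB | A B x r Hx Hr IH
    | A B r s Hr IHr Hs IHs | A B r s Hr IHr Hs IHs | A B r Hr IH].
  - destruct (splits_elim (Var x) A); simpl; auto. now constructor.
  - destruct IH as [|[|]]; auto. right; right. eapply splits_equiv; eassumption.
  - destruct IH as [IH|[[_ IH]|IH]].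
    + left. now apply hook_mod_lam, hook_step_mod.
    + left. now apply hook_mod_lam.
    + right; right. now apply splits_lam.
  - destruct (splits_elim (App r s) B); simpl; auto. eapply ty_app; eassumption.
  - destruct IHr as [IHr|[[_ IHr]|IHr]].
    + left. now apply hook_mod_prodl, hook_step_mod.
    + left. now apply hook_mod_prodl.
    + destruct IHs as [IHs|[[_ IHs]|IHs]].
      * left. now apply hook_mod_prodr, hook_step_mod.
      * left. now apply hook_mod_prodr.
      * right; right. now apply splits_prod.
  - destruct (splits_elim (Proj A r) A); simpl; auto. eapply ty_proj; eassumption.
Qed.

(** * Heads of closed eliminations *)

Lemma has_type_lam_inv x r T :
  has_type (Lam x r) T -> exists A B, V A x /\ has_type r B /\ A ⇒ B ≡ T.
Proof.
  remember (Lam x r) as u eqn:E. intros H; revert E.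
  induction H; intros E; try discriminate.
  - destruct (IHhas_type E) as (A' & B' & ? & ? & ?). exists A', B'. eauto.
  - injection E as -> ->. exists A, B. auto.
Qed.

Lemma has_type_prod_inv r s T :
  has_type (Prod r s) T -> exists A B, A ∧ B ≡ T.
Proof.
  remember (Prod r s) as u eqn:E. intros H; revert E.
  induction H; intros E; try discriminate.
  - destruct (IHhas_type E) as (A' & B' & ?). exists A', B'. eauto.
  - exists A, B. auto.
Qed.

Lemma conj_not_prime A B P : ~ factors_equiv (factors (A ∧ B)) [P].
Proof.
  intros H. apply PermutationA_length in H. simpl in H.
  pose proof (factors_nonempty A). pose proof (factors_nonempty B).
  rewrite length_app in H.
  destruct (factors A) as [|? [|]], (factors B); simpl in H; try easy.
Qed.

(** [Tau] has one factor, with no arguments, whereas every factor of an arrow has an argument and a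
    conjunction has at least two factors. *)
Lemma has_type_tau_elim r : has_type r Tau -> elim_or_var r.
Proof.
  intros H. destruct r; simpl; auto.
  - apply has_type_lam_inv in H as (A & B & _ & _ & H).
    apply factors_invariant, PermutationA_singleton in H as (P & E & HP);
      [|typeclasses eauto]. simpl in E.
    destruct (factors B) as [|Q [|]]; try discriminate E.
    injection E as <-. apply PermutationA_length in HP.
    rewrite length_app, length_map in HP.
    pose proof (factors_nonempty A). destruct (factors A); easy.
  - apply has_type_prod_inv in H as (A & B & H).
    apply factors_invariant in H. now apply conj_not_prime in H.
Qed.

(* The arguments [Ts] already received by the abstraction, followed by the
   arguments [Q] still expected by the prime type [A], are the arguments of the
   abstraction, which start with the primes of its domain [X]. *)
Definition applied_lam (r : preterm) (A : type) : Prop :=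
  exists x X b l Ts P Q,
    isos r (App (Lam x b) (bigprod l)) /\ V X x /\ l <> [] /\
    Forall2 has_type l Ts /\ factors_equiv (factors A) [Q] /\
    args_equiv (Ts ++ Q) (map arrows (factors X) ++ P).

Lemma applied_lam_equiv r A B : A ≡ B -> applied_lam r A -> applied_lam r B.
Proof.
  intros HAB (x & X & b & l & Ts & P & Q & H1 & H2 & H3 & H4 & H5 & H6).
  exists x, X, b, l, Ts, P, Q. repeat split; auto.
  etransitivity; [|exact H5]. symmetry. now apply factors_invariant.
Qed.

Lemma arr_prime A B P :
  factors_equiv (factors (A ⇒ B)) [P] ->
  exists Q, factors B = [Q] /\ args_equiv (map arrows (factors A) ++ Q) P.
Proof.
  intros H. apply PermutationA_singleton in H as (P' & E & HP); [|typeclasses eauto].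
  simpl in E. destruct (factors B) as [|Q [|]]; try discriminate E.
  exists Q. injection E as <-. auto.
Qed.

(** Currying merges the new argument into the product already received, and the primes of [A] pass
    from the expected arguments to the received ones. *)
Lemma applied_lam_app r s A B :
  applied_lam r (A ⇒ B) -> splits s A -> applied_lam (App r s) B.
Proof.
  intros (x & X & b & l & Ts & P & Q & H1 & H2 & H3 & H4 & H5 & H6) (l' & Hl' & HT').
  apply arr_prime in H5 as (Q' & E & HQ).
  pose proof (Forall2_nonempty _ _ _ HT' (map_arrows_factors_nonempty A)) as Hne.
  exists x, X, b, (l ++ l'), (Ts ++ map arrows (factors A)), P, Q'.
  repeat split; auto.
  - eapply isos_trans; [apply isos_appl, H1|].
    eapply isos_trans; [apply iso_isos, iso_curry|].
    apply isos_appr.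
    eapply isos_trans; [apply isos_prodr, Hl' | now apply bigprod_app].
  - intros E'. apply app_eq_nil in E'. tauto.
  - now apply Forall2_app.
  - now rewrite E.
  - rewrite <- app_assoc. rewrite <- H6.
    apply PermutationA_app; [typeclasses eauto | reflexivity | exact HQ].
Qed.

(** An irreducible body splits. With several components the abstraction is a product modulo [isos]
    and zeta fires; with one, the abstraction has a prime type. *)
Lemma lam_app x b s A B :
  has_type (Lam x b) (A ⇒ B) -> splits s A ->
  hook_mod (App (Lam x b) s) \/ applied_lam (App (Lam x b) s) B.
Proof.
  intros Hl (l' & Hl' & HT').
  apply has_type_lam_inv in Hl as (X & Y & Hx & Hb & HXY).
  assert (Hcases : step_mod b \/ splits b Y).
  { destruct (step_or_splits _ _ Hb) as [H|[[_ H]|H]]; auto using hook_step_mod. }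
  destruct Hcases as [H|(l & Hl & HT)].
  - left. now apply hook_mod_appl, hook_mod_lam.
  - destruct (factors Y) as [|P [|P' Ps]] eqn:E.
    + now apply factors_nonempty in E.
    + right. apply factors_invariant in HXY.
      assert (EX : factors (X ⇒ Y) = [map arrows (factors X) ++ P])
        by (simpl; now rewrite E).
      rewrite EX in HXY. symmetry in HXY.
      apply arr_prime in HXY as (Q & EQ & HQ).
      exists x, X, b, l', (map arrows (factors A)), P, Q.
      repeat split; auto.
      * now apply isos_appr.
      * eapply Forall2_nonempty; eauto using map_arrows_factors_nonempty.
      * now rewrite EQ.
    + left. destruct l as [|t [|t' l]]; [inversion HT | now inversion HT; inversion H4|].
      eapply hook_mod_isos;
        [apply isos_appl; eapply isos_trans; [apply isos_lam, Hl | now apply lam_bigprod]|].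
      simpl map. rewrite bigprod_cons by easy.
      eapply hook_mod_bpz, r_zeta.
Qed.

Lemma proj_splits r A B : splits r (A ∧ B) -> hook_mod (Proj A r).
Proof.
  intros (l & Hl & HT). simpl in HT. rewrite map_app in HT.
  apply Forall2_app_inv_r in HT as (l1 & l2 & H1 & H2 & ->).
  pose proof (Forall2_nonempty _ _ _ H1 (map_arrows_factors_nonempty A)) as N1.
  pose proof (Forall2_nonempty _ _ _ H2 (map_arrows_factors_nonempty B)) as N2.
  eapply hook_mod_isos;
    [apply isos_proj; eapply isos_trans; [exact Hl | now apply bigprod_app_sym]|].
  eapply hook_mod_bpz, r_pi.
  eapply ty_eq; [apply has_type_bigprod; [exact H1 | exact N1] | apply te_sym, factorisation].
Qed.

(** Closedness is followed along the head only, where it excludes variables; arguments are handled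
    by [step_or_splits], which holds for open terms. *)
Lemma closed_elim_head r A :
  has_type r A -> closed r -> hook_mod r \/ ~ elim_or_var r \/ applied_lam r A.
Proof.
  induction 1 as [A x Hx | A B r Hr IH HAB | A B x r Hx Hr IH
    | A B r s Hr IHr Hs IHs | A B r s Hr IHr Hs IHs | A B r Hr IH]; intros Hc.
  - destruct (Hc x). now left.
  - destruct (IH Hc) as [|[|]]; auto. right; right. eapply applied_lam_equiv; eassumption.
  - right; left. easy.
  - assert (Hcr : closed r) by (intros x Hx; apply (Hc x); simpl; apply in_or_app; auto).
    assert (Hcases : step_mod s \/ splits s A).
    { destruct (step_or_splits _ _ Hs) as [H|[[_ H]|H]]; auto using hook_step_mod. }
    destruct Hcases as [H|Hsplit]; [left; now apply hook_mod_appr|].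
    destruct (IHr Hcr) as [H|[H|H]].
    + left. now apply hook_mod_appl.
    + destruct r as [| x b | | r1 r2 |]; try (destruct H; exact I).
      * destruct (lam_app x b s A B Hr Hsplit); auto.
      * left. eapply hook_mod_bpz, r_zeta.
    + right; right. eapply applied_lam_app; eassumption.
  - right; left. easy.
  - destruct (IH Hc) as [H|[H|H]].
    + left. now apply hook_mod_proj.
    (* The projected term is an introduction, so it either has a [hook] step or splits into blocks
       on which pi fires. *)
    + left. destruct (step_or_splits _ _ Hr) as [H'|[[H' _]|H']].
      * now apply hook_mod_proj.
      * contradiction.
      * eapply proj_splits; eassumption.
    (* An applied abstraction has a prime type, so it cannot be projected. *)
    + destruct H as (x & X & b & l & Ts & P & Q & _ & _ & _ & _ & H & _).
      now apply conj_not_prime in H.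
Qed.

(** [Tau] expects no further argument, so the received ones can be permuted to begin with a block
    whose product has the type of the bound variable. *)
Lemma applied_lam_tau r : applied_lam r Tau -> hook_mod r.
Proof.
  intros (x & X & b & l & Ts & P & Q & H1 & HX & H3 & H4 & H5 & H6).
  assert (Q = []) as ->.
  { apply PermutationA_singleton in H5 as (P' & E & HP); [|typeclasses eauto].
    injection E as <-. apply PermutationA_length in HP. now destruct Q. }
  rewrite app_nil_r in H6.
  destruct (Forall2_has_type_permute _ _ H6 _ H4) as (l' & Hp & Hl').
  apply Forall2_app_inv_r in Hl' as (l1 & l2 & HT1 & HT2 & ->).
  pose proof (Forall2_nonempty _ _ _ HT1 (map_arrows_factors_nonempty X)) as N1.
  assert (HT : has_type (bigprod l1) X).
  { eapply ty_eq; [apply has_type_bigprod; [exact HT1 | exact N1] | apply te_sym, factorisation]. }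
  eapply hook_mod_isos;
    [eapply isos_trans; [exact H1 | apply isos_appr, bigprod_permutation, Hp]|].
  (* Without surplus arguments beta fires at the root; otherwise uncurrying the surplus back out
     puts the redex in function position. *)
  destruct l2 as [|t l2].
  - rewrite app_nil_r. eapply hook_mod_bpz, r_beta; eassumption.
  - eapply hook_mod_isos.
    + eapply isos_trans; [apply isos_appr, bigprod_app_sym; easy|].
      apply iso_isos, iso_sym, iso_curry.
    + eapply hook_mod_appl, hook_mod_bpz, r_beta; eassumption.
Qed.

Theorem mainTheorem3 : ~ exists r : preterm, closed r /\ has_type r Tau /\ normal r.
Proof.
  intros (r & Hc & Hr & Hn).
  assert (H : hook_mod r).
  { destruct (closed_elim_head r Tau Hr Hc) as [H|[H|H]].
    - assumption.
    - now apply has_type_tau_elim in Hr.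
    - now apply applied_lam_tau. }
  apply Hn. destruct H as (r' & s & H & Hs).
  exists s, r', s. split; [assumption | split; [now apply s_hook | apply isos_refl]].
Qed.
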